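(* Let $s>3$ be an integer, let $P=\{p_0,p_1,\dots,p_{s-1}\}$ be real numbers with $p_i>0$ for all $i$ and $p_0+p_1+\dots+p_{s-1}=1$, and let $u\in\{0,1,\dots,s-1\}$. Then the set $\mathbb S_{(-P,u)}\subset[0,1]$ is an uncountable, perfect, and nowhere dense set of zero Lebesgue measure.
   Context: Digits range over $A=\{0,1,\dots,s-1\}$. Put $\beta_0=0$ and $\beta_a=\sum_{i=0}^{a-1}p_i$ for $a\in\{1,\dots,s-1\}$. For a sequence $(\alpha_n)_{n\ge1}$ of digits in $A$, define the P-representation $$\Delta^{P}_{\alpha_1\alpha_2\ldots\alpha_n\ldots}=\beta_{\alpha_1}+\sum_{n=2}^{\infty}\Big(\beta_{\alpha_n}\prod_{j=1}^{n-1}p_{\alpha_j}\Big)\in[0,1],$$ and the nega-P-representation $$\Delta^{-P}_{\alpha_1\alpha_2\ldots\alpha_n\ldots}=\Delta^{P}_{\alpha_1[s-1-\alpha_2]\alpha_3[s-1-\alpha_4]\ldots\alpha_{2k-1}[s-1-\alpha_{2k}]\ldots},$$ i.e. digits in odd positions are kept and each digit $a$ in an even position is replaced by $s-1-a$ (brackets $[\cdot]$ enclose a single digit). The set $\mathbb S_{(-P,u)}$ is $$\mathbb S_{(-P,u)}=\Big\{x:\ x=\Delta^{-P}_{\underbrace{u\ldots u}_{\alpha_1-1}\alpha_1\underbrace{u\ldots u}_{\alpha_2-1}\alpha_2\ldots\underbrace{u\ldots u}_{\alpha_n-1}\alpha_n\ldots},\ \ \alpha_n\in\{1,2,\dots,s-1\}\setminus\{u\}\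 \text{for all } n\ge 1\Big\},$$ where the subscript is the infinite digit sequence obtained by concatenating, for $n=1,2,\dots$, the finite blocks consisting of $\alpha_n-1$ copies of the digit $u$ followed by the digit $\alpha_n$. A set of real numbers is perfect if it is closed and has no isolated points. *)

(* Defs.v *)
From HB Require Import structures.
From mathcomp Require Import all_boot all_order all_algebra.
From mathcomp Require Import all_classical all_reals all_analysis.

Set Implicit Arguments.
Unset Strict Implicit.
Unset Printing Implicit Defensive.

Import Order.TTheory GRing.Theory Num.Theory.
Import numFieldNormedType.Exports.

Local Open Scope classical_set_scope.
Local Open Scope ring_scope.

(* A digit sequence is a function [d : nat -> 'I_s] indexed from 0: the n-th  *)
(* digit (n >= 1) is [d n.-1].                                                *)

Definition beta (R : realType) (s : nat) (p : 'I_s -> R) (a : 'I_s) : R :=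
  \sum_(i < s | (i < a)%N) p i.

Definition P_rep (R : realType) (s : nat) (p : 'I_s -> R) (d : nat -> 'I_s) : R :=
  beta p (d 0%N) +
  limn (fun N : nat => \sum_(1 <= n < N) (beta p (d n) * \prod_(j < n) p (d j))).

(* Even positions are the odd indices here; [rev_ord a] is s - 1 - a. *)
Definition nega_digits (s : nat) (d : nat -> 'I_s) : nat -> 'I_s :=
  fun n => if odd n then rev_ord (d n) else d n.

Definition negaP_rep (R : realType) (s : nat) (p : 'I_s -> R)
    (d : nat -> 'I_s) : R :=
  P_rep p (nega_digits d).

Definition block (s : nat) (u a : 'I_s) : seq 'I_s := rcons (nseq a.-1 u) a.

(* The infinite concatenation of the blocks of [alpha 0], [alpha 1], etc.     *)
(* Every block is nonempty, so the first [k.+1] blocks already contain the    *)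
(* digit of index [k] and the default value of [nth] is never used.           *)
Definition block_concat (s : nat) (u : 'I_s) (alpha : nat -> 'I_s) :
    nat -> 'I_s :=
  fun k => nth u (flatten [seq block u (alpha n) | n <- iota 0 k.+1]) k.

Definition S_negaP (R : realType) (s : nat) (p : 'I_s -> R) (u : 'I_s) : set R :=
  [set x | exists alpha : nat -> 'I_s,
     (forall n, (0 < alpha n)%N /\ alpha n != u) /\
     x = negaP_rep p (block_concat u alpha)].

Definition nowhere_dense (T : topologicalType) (A : set T) : Prop :=
  interior (closure A) = set0.

(* Main.v *)
Require Import Defs.
From HB Require Import structures.
From mathcomp Require Import all_boot all_order all_algebra.
From mathcomp Require Import all_classical all_reals all_analysis.
From mathcomp Require Import zify ring lra.

Set Implicit Arguments.
Unset Strict Implicit.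

(* The map P is self-similar, P d = beta (d 0) + p (d 0) * P (shift 1 d), hence
   uniformly continuous in d, and d < e lexicographically gives P d < P e unless
   e has a vanishing tail.  No nega-transformed block sequence has a vanishing
   tail, so the set is an injective continuous image of the compact space of
   admissible alpha: it is closed, uncountable, and changing one far digit of
   alpha shows that it has no isolated point.  Some digit v never occurs twice in
   a row; the image of the sequences avoiding the corresponding pair at positions
   (2k, 2k+1) is covered by scaled copies of itself with total ratio
   1 - p v * p (s-1-v) < 1, so it is null, and a closed null set is nowhere
   dense. *)

Import Order.TTheory GRing.Theory Num.Theory.
Import numFieldNormedType.Exports.

Local Open Scope classical_set_scope.
Local Open Scope ring_scope.

Definition agree {T : Type} (n : nat) (d e : nat -> T) : Prop :=
  forall k, (k < n)%N -> d k = e k.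

Definition shift {T : Type} (n : nat) (d : nat -> T) : nat -> T :=
  fun k => d (n + k)%N.

(** * The P-representation: self-similarity, order and continuity *)

Section PRepresentation.
Context (R : realType) (s : nat) (p : 'I_s -> R).
Hypotheses (p_gt0 : forall i, 0 < p i) (p_sum1 : \sum_(i < s) p i = 1).

Let p_ge0 i : 0 <= p i. Proof. exact: ltW. Qed.

Lemma beta_ge0 a : 0 <= beta p a.
Proof. by apply: sumr_ge0 => i _. Qed.

Lemma beta_gt0 (a : 'I_s) : (0 < a)%N -> 0 < beta p a.
Proof.
move=> a_gt0; rewrite /beta (bigD1 (Ordinal (ltn_trans a_gt0 (ltn_ord a))))//=.
by rewrite ltr_pwDl//; apply: sumr_ge0 => i _.
Qed.

Lemma betaD (a : 'I_s) : beta p a + p a = \sum_(i < s | (i <= a)%N) p i.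
Proof.
rewrite [RHS](bigD1 a)//= addrC; congr +%R; apply: eq_bigl => i.
by rewrite ltn_neqAle andbC.
Qed.

Lemma betaD_le1 a : beta p a + p a <= 1.
Proof.
by rewrite betaD -p_sum1 [leRHS](bigID (fun i : 'I_s => (i <= a)%N))/= lerDl sumr_ge0.
Qed.

(** The intervals from [beta p a] to [beta p a + p a], which hold the values with first digit [a],
    lie from left to right without overlap. *)
Lemma betaD_le (a b : 'I_s) : (a < b)%N -> beta p a + p a <= beta p b.
Proof.
move=> ab; rewrite betaD /beta [leRHS](bigID (fun i : 'I_s => (i <= a)%N))/=.
rewrite [X in _ <= X + _](eq_bigl (fun i : 'I_s => (i <= a)%N)).
  by rewrite lerDl sumr_ge0.
by move=> i; case: (leqP i a) => ia; rewrite ?andbF// andbT (leq_ltn_trans ia).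
Qed.

(** Starting at [n = 0], where the product is empty, makes the leading term of [P_rep] an ordinary
    one; the partial sums then satisfy a recursion under [shift 1]. *)
Definition P_psum (d : nat -> 'I_s) (N : nat) : R :=
  \sum_(0 <= n < N) (beta p (d n) * \prod_(j < n) p (d j)).

Lemma P_psumS d N :
  P_psum d N.+1 = beta p (d 0) + p (d 0) * P_psum (shift 1 d) N.
Proof.
rewrite /P_psum big_nat_recl// big_ord0 mulr1 big_distrr/=; congr +%R.
by apply: eq_bigr => i _; rewrite big_ord_recl/= mulrCA.
Qed.

Lemma P_psum_itv d N : 0 <= P_psum d N <= 1.
Proof.
elim: N d => [|N IH] d; first by rewrite /P_psum big_geq// lexx ler01.
have /andP[ge0 le1] := IH (shift 1 d); rewrite P_psumS; apply/andP; split.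
  by rewrite addr_ge0 ?mulr_ge0 ?beta_ge0.
by apply: le_trans (betaD_le1 (d 0)); rewrite lerD2l ler_piMr.
Qed.

Lemma P_psum_cvg d : P_psum d N @[N --> \oo] --> P_rep p d.
Proof.
have nd : nondecreasing_seq (P_psum d).
  apply/nondecreasing_seqP => N; rewrite /P_psum big_nat_recr//= lerDl.
  by rewrite mulr_ge0 ?beta_ge0// prodr_ge0.
have cv : cvgn (P_psum d).
  apply: nondecreasing_is_cvgn => //; exists 1 => _ [N _ <-].
  by have /andP[] := P_psum_itv d N.
rewrite /P_rep.
suff -> : limn (fun N => \sum_(1 <= n < N) (beta p (d n) * \prod_(j < n) p (d j)))
    = limn (P_psum d) - beta p (d 0) by rewrite addrC subrK.
apply: cvg_lim; first exact: Rhausdorff.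
rewrite -cvg_shiftS/=.
rewrite [X in X @ _ --> _](_ : _ = (fun N => P_psum d N.+1 - beta p (d 0))).
  by apply: cvgB; [rewrite (cvg_shiftS (P_psum d)); exact: cv | exact: cvg_cst].
apply/funext => N; rewrite /P_psum [in RHS]big_ltn// big_ord0 mulr1 addrC.
by rewrite addKr.
Qed.

Lemma P_rep_recl d : P_rep p d = beta p (d 0) + p (d 0) * P_rep p (shift 1 d).
Proof.
have /(cvg_lim (@Rhausdorff R)) <- : P_psum d N.+1 @[N --> \oo] --> P_rep p d.
  by rewrite (cvg_shiftS (P_psum d)); exact: P_psum_cvg.
apply: cvg_lim; first exact: Rhausdorff.
under eq_fun do rewrite P_psumS.
apply: cvgD; first exact: cvg_cst.
by apply: cvgZr; exact: P_psum_cvg.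
Qed.

Lemma P_rep_itv d : 0 <= P_rep p d <= 1.
Proof.
have /(cvg_lim (@Rhausdorff R)) <- := @P_psum_cvg d.
have cv := cvgP _ (@P_psum_cvg d).
apply/andP; split; [apply: limr_ge|apply: limr_le] => //;
  by apply: nearW => N; have /andP[] := P_psum_itv d N.
Qed.

Lemma P_rep_gt0 (d : nat -> 'I_s) n : (0 < d n)%N -> 0 < P_rep p d.
Proof.
elim: n d => [|n IH] d dn; rewrite P_rep_recl.
  rewrite ltr_pwDl ?beta_gt0// mulr_ge0//.
  by have /andP[] := P_rep_itv (shift 1 d).
by rewrite ltr_wpDl ?beta_ge0// mulr_gt0// IH.
Qed.

(** Self-similarity strips the common prefix. The first remaining digits put the two values in
    non-overlapping intervals, and the nonzero digit [e n] keeps the larger value off its left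
    endpoint. *)
Lemma P_rep_lt k (d e : nat -> 'I_s) n : agree k d e -> (d k < e k)%N -> (k < n)%N ->
  (0 < e n)%N -> P_rep p d < P_rep p e.
Proof.
elim: k d e n => [|k IH] d e [//|n] de dek kn en.
  have lt1 : P_rep p d <= beta p (d 0) + p (d 0).
    rewrite P_rep_recl lerD2l ler_piMr//.
    by have /andP[] := P_rep_itv (shift 1 d).
  rewrite (le_lt_trans lt1)// (le_lt_trans (betaD_le dek))// [ltRHS]P_rep_recl.
  by rewrite ltrDl mulr_gt0// (P_rep_gt0 (n := n)).
rewrite [ltLHS]P_rep_recl [ltRHS]P_rep_recl de// ltrD2l ltr_pM2l//.
by apply: (IH _ _ n) => // i ik; exact: de.
Qed.

(** The largest weight leaves room for another positive one in a sum equal to 1. This [c] is the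
    contraction ratio per common digit. *)
Lemma p_lt1 (s_gt1 : (1 < s)%N) : exists2 c, c < 1 & forall i, p i <= c.
Proof.
have i0 : 'I_s := Ordinal (ltn_trans (ltnSn 0) s_gt1).
have [i _ iM] := arg_maxP p (isT : xpredT i0); exists (p i); last first.
  by move=> j; exact: iM.
have [j jNi] : exists j : 'I_s, j != i.
  case: (eqVneq i (Ordinal s_gt1)) => [->|].
    by exists (Ordinal (ltn_trans (ltnSn 0) s_gt1)).
  by rewrite eq_sym; exists (Ordinal s_gt1).
rewrite -p_sum1 (bigD1 i)//= ltrDl (bigD1 j)//=.
by rewrite ltr_pwDl// sumr_ge0.
Qed.

Lemma P_rep_dist c n d e : (forall i, p i <= c) -> agree n d e ->
  `|P_rep p d - P_rep p e| <= c ^+ n.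
Proof.
move=> pc; elim: n d e => [|n IH] d e de.
  have := P_rep_itv d; have := P_rep_itv e.
  by rewrite expr0 ler_norml; lra.
rewrite P_rep_recl [P_rep p e]P_rep_recl -de// opprD addrACA subrr add0r.
rewrite -mulrBr normrM (ger0_norm (p_ge0 _)) exprS ler_pM//.
by apply: IH => k kn; exact: de.
Qed.

Lemma P_rep_ucont (s_gt1 : (1 < s)%N) eps : 0 < eps ->
  exists n, forall d e, agree n d e -> `|P_rep p d - P_rep p e| < eps.
Proof.
move=> eps_gt0; have [c c_lt1 pc] := p_lt1 s_gt1.
have c_ge0 : 0 <= c := le_trans (p_ge0 (Ordinal s_gt1)) (pc _).
have : c ^+ n @[n --> \oo] --> 0 by apply: cvg_expr; rewrite ger0_norm.
move=> /cvgr0Pnorm_lt/(_ _ eps_gt0)[n _ nP]; exists n => d e de.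
apply: le_lt_trans (P_rep_dist pc de) _.
by have := nP n (leqnn n); rewrite ger0_norm// exprn_ge0.
Qed.

End PRepresentation.

(** * Concatenated blocks and the recovery of [alpha] *)

Section BlockConcatenation.
Context (s : nat) (u : 'I_s).

Lemma size_block (a : 'I_s) : size (block u a) = a.-1.+1.
Proof. by rewrite size_rcons size_nseq. Qed.

Lemma size_blocks (alpha : nat -> 'I_s) n :
  (n <= size (flatten [seq block u (alpha i) | i <- iota 0 n]))%N.
Proof.
elim: n => // n IH; rewrite -addn1 iotaD map_cat flatten_cat size_cat/= cats0.
by rewrite leq_add// size_block.
Qed.

Lemma nth_blocks (alpha : nat -> 'I_s) n k : (k < n)%N ->
  nth u (flatten [seq block u (alpha i) | i <- iota 0 n]) k =
  block_concat u alpha k.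
Proof.
move=> kn; rewrite -(subnKC kn) iotaD map_cat flatten_cat nth_cat.
by rewrite (leq_trans (ltnSn k) (size_blocks alpha k.+1)).
Qed.

Lemma block_concat_head (alpha : nat -> 'I_s) k : (k < alpha 0%N)%N ->
  block_concat u alpha k = if k.+1 == alpha 0%N :> nat then alpha 0%N else u.
Proof.
move=> k_lt; rewrite /block_concat/= nth_cat size_block (ltn_predK k_lt) k_lt.
rewrite /block nth_rcons size_nseq nth_nseq -(inj_eq succn_inj) (ltn_predK k_lt).
rewrite -ltnS (ltn_predK k_lt).
have [->|kN] := eqVneq k.+1 (val (alpha 0%N)); first by rewrite ltnn.
by case: ifP => //; rewrite if_same.
Qed.

Lemma block_concat_tail (alpha : nat -> 'I_s) k : (0 < alpha 0%N)%N ->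
  block_concat u alpha (alpha 0%N + k) = block_concat u (shift 1 alpha) k.
Proof.
move=> a_gt0; rewrite {1}/block_concat.
rewrite [iota _ _]/= [map _ _]/= [flatten _]/= nth_cat size_block prednK//.
rewrite ltnNge leq_addr/= addKn (iotaDl 1 0) -map_comp.
(* Removing the first block leaves [alpha 0%N + k] blocks, more than [k] since [alpha 0%N] is
   positive. *)
by rewrite -(@nth_blocks _ (alpha 0%N + k))// -[ltnLHS]add0n ltn_add2r.
Qed.

Lemma block_concat_agree n (alpha alpha' : nat -> 'I_s) :
  agree n alpha alpha' -> agree n (block_concat u alpha) (block_concat u alpha').
Proof.
move=> aa k kn; rewrite /block_concat; congr (nth _ (flatten _) _).
apply/eq_in_map => i; rewrite mem_iota/= ltnS => ik.
by rewrite aa// (leq_ltn_trans ik).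
Qed.

Definition admissible (alpha : nat -> 'I_s) : Prop :=
  forall n, (0 < alpha n)%N /\ alpha n != u.

Lemma admissible_shift n alpha : admissible alpha -> admissible (shift n alpha).
Proof. by move=> adm k; exact: adm. Qed.

(** The first digit other than [u] closes the first block and so reveals [alpha 0%N]; the later
    terms follow by shifting. *)
Lemma block_concat_inj alpha alpha' : admissible alpha -> admissible alpha' ->
  block_concat u alpha =1 block_concat u alpha' -> alpha =1 alpha'.
Proof.
have head_le b b' : admissible b -> admissible b' ->
    block_concat u b =1 block_concat u b' -> (b' 0%N <= b 0%N)%N.
  move=> adm adm' e; have [b_gt0 bu] := adm 0%N; rewrite leqNgt; apply/negP => lt.
  have := e (b 0%N).-1; rewrite (block_concat_head (alpha := b)) ?prednK//.
  rewrite eqxx block_concat_head ?prednK// ?(ltnW lt)//.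
  by rewrite ltn_eqF// => bE; rewrite bE eqxx in bu.
move=> + + + n; elim: n alpha alpha' => [|n IH] b b' adm adm' e.
  by apply/val_inj/anti_leq/andP; split; apply: head_le.
apply: (IH (shift 1 b) (shift 1 b')); try exact: admissible_shift.
have b0 : b 0%N = b' 0%N by apply/val_inj/anti_leq/andP; split; apply: head_le.
move=> k; rewrite -!block_concat_tail; try by have [] := adm 0%N; have [] := adm' 0%N.
by rewrite e b0.
Qed.

(** A digit other than [u] can only close a block, whose length is the value of that digit. The
    induction strips leading blocks until index [k] falls in the first one. *)
Lemma block_concat_run alpha k : admissible alpha -> block_concat u alpha k != u ->
  (0 < block_concat u alpha k)%N /\
  forall j, (0 < j < block_concat u alpha k)%N ->
    (j <= k)%N /\ block_concat u alpha (k - j) = u.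
Proof.
elim/ltn_ind: k alpha => k IH alpha adm; have [a_gt0 au] := adm 0%N.
have [k_lt|k_ge] := ltnP k (alpha 0%N).
  rewrite block_concat_head//.
  case: (eqVneq k.+1 (alpha 0%N : nat)) => [ka _|_]; last by rewrite eqxx.
  split=> // j /andP[j_gt0 j_lt]; split; first by lia.
  rewrite block_concat_head ?(leq_ltn_trans (leq_subr j k))//.
  by rewrite ifN//; apply/eqP; lia.
rewrite -(subnKC k_ge) block_concat_tail// => du.
have [|d_gt0 dP] := IH (k - alpha 0%N)%N _ _ (admissible_shift 1 adm) du; first by lia.
split=> // j jd; have [jk jE] := dP j jd; split; first by lia.
by rewrite -addnBA// block_concat_tail.
Qed.

End BlockConcatenation.

(** * Closed images of closed sets of sequences over a finite alphabet *)

Section CompactnessOfSequences.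
Context (R : realType) (T : finType) (F : (nat -> T) -> R) (D : set (nat -> T)).
Hypotheses
  (F_ucont : forall eps, 0 < eps ->
     exists n, forall d e, agree n d e -> `|F d - F e| < eps)
  (D_closed : forall d, (forall n, exists2 e, D e & agree n d e) -> D d).

(* Koenig's lemma: Z n w says that x is adherent to the values of F on the
   sequences of D that extend the first n terms of w. *)
Lemma closed_image_ucont : closed [set F d | d in D].
Proof.
move=> x Fx.
pose Z n w := closure [set F d | d in [set d | D d /\ agree n w d]] x.
pose upd n (w : nat -> T) t k := if (k < n)%N then w k else t.
have Z_inh n w : Z n w -> exists2 d, D d & agree n w d.
  by move=> /(_ setT filterT)[_ [[d [Dd wd] _] _]]; exists d.
have [w0 _] : exists w0 : nat -> T, True.
  by have [_ [[d _ _] _]] := Fx setT filterT; exists d.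
have /choice[t tP] : forall nw : nat * (nat -> T), exists t,
    Z nw.1 nw.2 -> Z nw.1.+1 (upd nw.1 nw.2 t).
  move=> [n w] /=; apply: contrapT => /forallNP noZ.
  have Zw : Z n w by apply: contrapT => nZ; apply: (noZ (w 0%N)) => /nZ.
  (* The finitely many choices of the next term split the extensions of the prefix, and a finite
     union of closures is closed, so [x] is adherent to one of the pieces. *)
  pose G t := closure [set F d | d in [set d | D d /\ agree n.+1 (upd n w t) d]].
  have clG : closed (\big[setU/set0]_(t <- enum T) G t).
    by apply: closed_bigsetU => t _; exact: closed_closure.
  have : (\big[setU/set0]_(t <- enum T) G t) x.
    apply/clG; apply: closureS Zw => _ [d [Dd wd] <-].
    rewrite -bigcup_seq; exists (d n); first by rewrite /= mem_enum.
    apply: subset_closure; exists d => //; split=> // k; rewrite /upd ltnS.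
    by rewrite leq_eqVlt => /predU1P[->|kn]; rewrite ?ltnn// kn wd.
  rewrite -bigcup_seq => -[t _ Gt].
  by apply: (noZ t).
pose W := fix W n := if n is m.+1 then upd m (W m) (t (m, W m)) else w0.
have ZW n : Z n (W n).
  elim: n => [|n IH]; last exact: (tP (n, W n)).
  by apply: closureS Fx => _ [d Dd <-]; exists d.
(* Passing from [W n] to [W n.+1] keeps the first [n] terms, so term [k] is final from stage [k.+1]
   on. *)
pose w k := W k.+1 k.
have wW n : agree n w (W n).
  elim: n => // n IH k; rewrite ltnS leq_eqVlt => /predU1P[->//|kn].
  by rewrite IH// /= /upd kn.
exists w.
  apply: D_closed => n; have [d Dd Wd] := Z_inh n _ (ZW n).
  by exists d => // k kn; rewrite (wW n)// Wd.
apply: contrapT => /eqP Fw.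
have [n nP] : exists n, forall d e, agree n d e -> `|F d - F e| < `|F w - x| / 2.
  by apply: F_ucont; rewrite divr_gt0// normr_gt0 subr_eq0.
have eps_gt0 : 0 < `|F w - x| / 2 by rewrite divr_gt0// normr_gt0 subr_eq0.
have [_ [[d [_ Wd] <-]]] := ZW n _ (nbhsx_ballx x _ eps_gt0).
have /nP wd : agree n w d by move=> k kn; rewrite (wW n)// Wd.
rewrite -ball_normE/= => xd.
have := ler_distD (F d) (F w) x; rewrite [X in _ <= _ + X]distrC.
by move: xd wd; lra.
Qed.

End CompactnessOfSequences.

(** * Lebesgue measure of arbitrary sets *)

(** Holds by unfolding; monotonicity and subadditivity thus follow without any measurability of the
    sets. *)
Lemma lebesgue_outer_measure (R : realType) (A : set R) :
  lebesgue_measure A = (wlength idfun)^*%mu A.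
Proof. by []. Qed.

Lemma le_lebesgue_measure (R : realType) (A B : set R) : A `<=` B ->
  (lebesgue_measure A <= lebesgue_measure B)%E.
Proof. by move=> AB; rewrite !lebesgue_outer_measure; exact: le_outer_measure. Qed.

Lemma lebesgue_measure_bigsetU (R : realType) (I : Type) (r : seq I)
    (P : pred I) (A : I -> set R) :
  (lebesgue_measure (\big[setU/set0]_(i <- r | P i) A i) <=
   \sum_(i <- r | P i) lebesgue_measure (A i))%E.
Proof.
apply: (big_ind2 (fun (B : set R) x => lebesgue_measure B <= x)%E) => //.
  by rewrite measure0.
move=> B x C y Bx Cy; apply: le_trans (leeD Bx Cy).
by rewrite !lebesgue_outer_measure; exact: outer_measureU2.
Qed.

Lemma lebesgue_null_nowhere_dense (R : realType) (A : set R) : closed A ->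
  lebesgue_measure A = 0%E -> nowhere_dense A.
Proof.
move=> /closure_id clA A0; rewrite /nowhere_dense -clA -subset0 => x.
rewrite /interior => /nbhs_ballP[e /= e_gt0 /le_lebesgue_measure].
rewrite lebesgue_measure_ball ?(ltW e_gt0)// A0 lee_fin.
by rewrite leNgt pmulrn_lgt0// e_gt0.
Qed.

(** * Sequences avoiding a pair of digits have a null image *)

Section AvoidingAPair.
Context (R : realType) (s : nat) (p : 'I_s -> R).
Hypotheses (p_gt0 : forall i, 0 < p i) (p_sum1 : \sum_(i < s) p i = 1).
Context (v v' : 'I_s).

(** Only disjoint aligned pairs are constrained, so [shift 2] preserves the set and each pair is a
    free choice. *)
Definition avoiding : set (nat -> 'I_s) :=
  [set d | forall k, (d k.*2, d k.*2.+1) != (v, v')].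

(* Two steps of the self-similarity turn an affine copy of the image of
   [avoiding] into one copy for every allowed pair of first two digits. *)
Lemma lebesgue_avoiding_le n x r : 0 <= r ->
  (lebesgue_measure [set (x + r * P_rep p d)%R | d in avoiding] <=
   (r * (1 - p v * p v') ^+ n)%:E)%E.
Proof.
elim: n x r => [|n IH] x r r_ge0.
  rewrite mulr1; apply: (@le_trans _ _ (lebesgue_measure `[x, x + r])).
    apply: le_lebesgue_measure => _ [d _ <-].
    have /andP[P0 P1] := P_rep_itv p_gt0 p_sum1 d.
    by rewrite /= in_itv/= lerDl mulr_ge0//= lerD2l ler_piMr.
  rewrite lebesgue_measure_itv/=; case: ifP => _; last by rewrite lee_fin.
  by rewrite -EFinD [x + r]addrC addrK.
pose y (ab : 'I_s * 'I_s) := x + r * (beta p ab.1 + p ab.1 * beta p ab.2).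
pose A ab := [set y ab + r * (p ab.1 * p ab.2) * P_rep p d | d in avoiding].
apply: (@le_trans _ _
    (lebesgue_measure (\big[setU/set0]_(ab | ab != (v, v')) A ab))).
  apply: le_lebesgue_measure => _ [d dv <-]; rewrite -bigcup_seq_cond.
  exists (d 0%N, d 1%N); first by rewrite /= mem_index_enum; exact: dv 0%N.
  exists (shift 2 d); first by move=> k; exact: (dv k.+1).
  rewrite /y/= (P_rep_recl _ _ d)// (P_rep_recl _ _ (shift 1 d))//.
  rewrite (_ : shift 1 d 0%N = d 1%N)// (_ : shift 1 (shift 1 d) = shift 2 d)//.
  ring.
apply: le_trans (lebesgue_measure_bigsetU _ _ _) _.
apply: (@le_trans _ _ (\sum_(ab | ab != (v, v'))
    (r * (p ab.1 * p ab.2) * (1 - p v * p v') ^+ n)%:E)%E).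
  by apply: lee_sum => ab _; apply: IH; rewrite !mulr_ge0// ltW.
rewrite sumEFin lee_fin -big_distrl -big_distrr/= exprS mulrA.
(* Over all pairs the products sum to the square of [\sum_i p i], which is 1; the forbidden pair is
   subtracted. *)
rewrite (_ : \sum_(ab | ab != (v, v')) _ = 1 - p v * p v')//.
have : \sum_ab p ab.1 * p ab.2 = 1.
  rewrite -(pair_bigA _ (fun a b => p a * p b))/=.
  under eq_bigr do rewrite -big_distrr/= p_sum1 mulr1.
  exact: p_sum1.
by rewrite (bigD1 (v, v'))//= => <-; rewrite addrAC subrr add0r.
Qed.

Lemma lebesgue_avoiding0 :
  lebesgue_measure [set P_rep p d | d in avoiding] = 0%E.
Proof.
apply/eqP; rewrite eq_le measure_ge0 andbT; apply/lee_addgt0Pr => eps eps_gt0.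
have p_le1 i : p i <= 1.
  by apply: le_trans (betaD_le1 p_gt0 p_sum1 i); rewrite lerDr (beta_ge0 p_gt0).
have q_ge0 : 0 <= 1 - p v * p v' by rewrite subr_ge0 mulr_ile1// ltW.
have : (1 - p v * p v') ^+ n @[n --> \oo] --> 0.
  by apply: cvg_expr; rewrite ger0_norm// ltrBlDr ltrDl mulr_gt0.
move=> /cvgr0Pnorm_lt/(_ _ eps_gt0)[n _ /(_ n (leqnn n))].
rewrite ger0_norm ?exprn_ge0// => q_lt; rewrite add0e.
have := lebesgue_avoiding_le n 0 ler01; rewrite mul1r => qn.
apply: le_trans (le_trans qn _); last by rewrite lee_fin ltW.
by apply: le_lebesgue_measure => _ [d dv <-]; exists d => //; rewrite add0r mul1r.
Qed.

End AvoidingAPair.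

(** * The set [S_negaP] as an injective image of the admissible sequences *)

Lemma nega_digits_agree (s n : nat) (d e : nat -> 'I_s) :
  agree n d e -> agree n (nega_digits d) (nega_digits e).
Proof. by move=> de k kn; rewrite /nega_digits de. Qed.

Lemma nega_digits_inj (s : nat) (d e : nat -> 'I_s) :
  nega_digits d =1 nega_digits e -> d =1 e.
Proof.
move=> de k; have := de k; rewrite /nega_digits.
by case: ifP => // _ /rev_ord_inj.
Qed.

(** Two of the digits 1, 2, 3 differ from [u]. The pair gives the binary freedom for perfectness and
    uncountability; [b > 1] gives a digit that is never doubled. *)
Lemma exists_two_letters (s : nat) (u : 'I_s) : (3 < s)%N ->
  exists a b : 'I_s,
    [/\ (0 < a)%N, a != u, (1 < b)%N, b != u & a != b].
Proof.
move=> s_gt3; pose i k (k3 : (k < 4)%N) : 'I_s := Ordinal (leq_trans k3 s_gt3).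
have [u2|u2] := eqVneq (u : nat) 2%N.
  by exists (@i 1%N isT), (@i 3%N isT); split; rewrite // -val_eqE/= u2.
have [u1|u1] := eqVneq (u : nat) 1%N.
  by exists (@i 3%N isT), (@i 2%N isT); split; rewrite // -val_eqE/= u1.
by exists (@i 1%N isT), (@i 2%N isT); split; rewrite // -val_eqE/= eq_sym.
Qed.

Section NegaPSet.
Context (R : realType) (s : nat) (s_gt3 : (3 < s)%N) (p : 'I_s -> R) (u : 'I_s).
Hypotheses (p_gt0 : forall i, 0 < p i) (p_sum1 : \sum_(i < s) p i = 1).

Definition block_point (alpha : nat -> 'I_s) : R :=
  negaP_rep p (block_concat u alpha).

Lemma S_negaPE : S_negaP p u = [set block_point alpha | alpha in admissible u].
Proof.
by apply/seteqP; split=> x [alpha]; [case=> adm ->|move=> adm <-]; exists alpha.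
Qed.

Lemma block_point_ucont eps : 0 < eps -> exists n, forall alpha alpha',
  agree n alpha alpha' -> `|block_point alpha - block_point alpha'| < eps.
Proof.
move=> eps_gt0; have s_gt1 : (1 < s)%N by exact: ltn_trans s_gt3.
have [n nP] := P_rep_ucont p_gt0 p_sum1 s_gt1 eps_gt0; exists n => alpha alpha' aa.
exact/nP/nega_digits_agree/block_concat_agree.
Qed.

(* A vanishing tail would read ... 0 [s-1] 0 [s-1] ... in the original digits;
   but 0 occurs only if u = 0, and then s-1 is preceded by s-2 > 1 zeros. *)
Lemma nega_block_concat_neq0 alpha k : admissible u alpha ->
  exists2 n, (k < n)%N & (0 < nega_digits (block_concat u alpha) n)%N.
Proof.
move=> adm; apply: contrapT => no.
have all0 n : (k < n)%N -> nega_digits (block_concat u alpha) n = 0%N :> nat.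
  move=> kn; apply/eqP; rewrite -leqn0 leqNgt; apply/negP => n_gt0.
  by apply: no; exists n.
set d := block_concat u alpha in all0.
have even0 m : (k < m.*2)%N -> d m.*2 = 0%N :> nat.
  by move=> /all0; rewrite /nega_digits odd_double.
have odd0 m : (k < m.*2)%N -> d m.*2.+1 = s.-1 :> nat.
  move=> km; have := all0 m.*2.+1 (leqW km).
  by rewrite /nega_digits /= odd_double/=; have := ltn_ord (d m.*2.+1); lia.
pose m := k.+1.
have km : (k < m.*2)%N by rewrite /m; lia.
(* Digits other than [u] are positive, so this zero must be [u]. *)
have d0u : d m.*2 = u.
  apply/eqP/negPn/negP => /(block_concat_run adm)[+ _].
  by rewrite -/d even0.
have u0 : u = 0%N :> nat by rewrite -d0u even0.
have km1 : (k < m.+1.*2)%N by lia.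
have [|_ run] := @block_concat_run _ u alpha m.+1.*2.+1 adm.
  by rewrite -/d -val_eqE/= odd0// u0; lia.
(* As [s > 3], the digit [s.-1] exceeds 2, so [u = 0] stands two places before it; but that odd
   index also carries [s.-1]. *)
have [|_] := run 2%N; first by rewrite -/d odd0//; lia.
rewrite (_ : (m.+1.*2.+1 - 2)%N = m.*2.+1); last by rewrite doubleS; lia.
by move=> /(congr1 val)/=; rewrite -/d odd0// u0; lia.
Qed.

(** At the first index where the transformed digits differ, [P_rep_lt] applies in one direction or
    the other, because neither tail vanishes. *)
Lemma block_point_inj alpha alpha' : admissible u alpha -> admissible u alpha' ->
  block_point alpha = block_point alpha' -> alpha =1 alpha'.
Proof.
move=> adm adm' e; apply: (block_concat_inj adm adm'); apply: nega_digits_inj.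
move: e; rewrite /block_point /negaP_rep.
set d := nega_digits _; set d' := nega_digits _ => e.
apply: contrapT => /existsNP/cid[k0 dd'].
have ex_k : exists k, d k != d' k by exists k0; exact/eqP.
case: (ex_minnP ex_k) => k kN kmin.
have agr : agree k d d'.
  by move=> i ik; apply/eqP/negPn/negP => /kmin; rewrite leqNgt ik.
have [n kn dn] := nega_block_concat_neq0 k adm.
have [n' kn' dn'] := nega_block_concat_neq0 k adm'.
move: kN; rewrite -val_eqE neq_ltn => /orP[lt|lt].
  by have := P_rep_lt p_gt0 p_sum1 agr lt kn' dn'; rewrite e ltxx.
have agr' : agree k d' d by move=> i ik; rewrite agr.
by have := P_rep_lt p_gt0 p_sum1 agr' lt kn dn; rewrite e ltxx.
Qed.

Lemma S_negaP_closed : closed (S_negaP p u).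
Proof.
rewrite S_negaPE; apply: closed_image_ucont; first exact: block_point_ucont.
(* Admissibility at [n] concerns only term [n], which a prefix of length [n.+1] contains. *)
move=> alpha alphaP n; have [alpha' adm aa] := alphaP n.+1.
by rewrite aa//; exact: adm.
Qed.

Lemma S_negaP_perfect : perfect_set (S_negaP p u).
Proof.
split; first exact: S_negaP_closed.
apply/seteqP; split=> x.
  move=> xlim; apply: S_negaP_closed => U /xlim[y [_ Sy Uy]].
  by exists y.
rewrite S_negaPE => -[alpha adm <-] U /nbhs_ballP[e /= e_gt0 eU].
have [a [b [a_gt0 au b_gt1 bu ab]]] := exists_two_letters u s_gt3.
have [n nP] := block_point_ucont e_gt0.
(* Term [n] is replaced by whichever of [a], [b] surely differs from it. *)
pose alpha' k := if k == n then (if alpha n == a then b else a) else alpha k.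
have adm' : admissible u alpha'.
  move=> k; rewrite /alpha'; case: ifP => _; last exact: adm.
  by case: ifP => _; split=> //; exact: ltnW.
exists (block_point alpha'); split; last 2 first.
- by exists alpha'.
- apply: eU; rewrite -ball_normE/=; apply: nP => k kn.
  by rewrite /alpha' ltn_eqF.
apply/eqP => /(block_point_inj adm' adm)/(_ n); rewrite /alpha' eqxx.
by case: ifPn => [/eqP-> ba|aN /esym/eqP]; [rewrite ba eqxx in ab|exact/negP].
Qed.

Lemma S_negaP_uncountable : ~ countable (S_negaP p u).
Proof.
rewrite S_negaPE => /countable_injP[f f_inj].
have [a [b [a_gt0 au b_gt1 bu ab]]] := exists_two_letters u s_gt3.
pose al (c : nat -> bool) n := if c n then a else b.
have adm c : admissible u (al c).
  by move=> n; rewrite /al; case: ifP => _; split=> //; exact: ltnW.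
pose g c := f (block_point (al c)).
have g_inj c c' : g c = g c' -> c =1 c'.
  move=> gc n.
  have /(block_point_inj (adm c) (adm c'))/(_ n) :
      block_point (al c) = block_point (al c').
    by apply: f_inj gc; rewrite inE; [exists (al c)|exists (al c')].
  by rewrite /al; case: (c n) (c' n) => -[]// /eqP; rewrite ?[b == a]eq_sym (negPf ab).
(* Cantor's diagonal: by injectivity of [g], only [c] itself is relevant at [g c], so [c (g c)]
   would have to be its own negation. *)
pose c n := `[< forall c', g c' = n -> c' n = false >].
have : c (g c) = false.
  by apply/asboolPn => cP; have := cP c erefl; rewrite /c; move/asboolPn; apply.
move=> cF; have : c (g c) by apply/asboolP => c' /g_inj ->.
by rewrite cF.
Qed.

(* A digit v > 1 other than u closes a block and is preceded by u, so the pair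
   (v, v) never occurs; at positions (2k, 2k+1) it reads (v, s-1-v). *)
Lemma S_negaP_null : lebesgue_measure (S_negaP p u) = 0%E.
Proof.
have [_ [v [_ _ v_gt1 vu _]]] := exists_two_letters u s_gt3.
apply/eqP; rewrite eq_le measure_ge0 andbT.
rewrite -(lebesgue_avoiding0 p_gt0 p_sum1 v (rev_ord v)); apply: le_lebesgue_measure.
rewrite S_negaPE => _ [alpha adm <-].
exists (nega_digits (block_concat u alpha)) => // k.
rewrite /nega_digits/= odd_double/= xpair_eqE.
apply/negP => /andP[/eqP dk /eqP/rev_ord_inj dk1].
have [|_ run] := @block_concat_run _ u alpha k.*2.+1 adm; first by rewrite dk1.
have [|_] := run 1%N; first by rewrite dk1.
by rewrite subn1/= dk => /eqP; exact/negP.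
Qed.

End NegaPSet.

Theorem theorem8 (R : realType) (s : nat) (hs : (3 < s)%N) (p : 'I_s -> R)
    (p_gt0 : forall i, 0 < p i) (p_sum1 : \sum_(i < s) p i = 1) (u : 'I_s) :
  S_negaP p u `<=` `[0, 1] /\
  ~ countable (S_negaP p u) /\
  perfect_set (S_negaP p u) /\
  nowhere_dense (S_negaP p u) /\
  lebesgue_measure (S_negaP p u) = 0%E.
Proof.
have null := S_negaP_null hs u p_gt0 p_sum1.
split=> [_ [alpha [_ ->]]|]; first by rewrite /= in_itv/=; exact: P_rep_itv.
split; first exact: S_negaP_uncountable.
split; first exact: S_negaP_perfect.
split=> //; apply: lebesgue_null_nowhere_dense => //; exact: S_negaP_closed.
Qed.
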